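(* Let $G$ and $H$ be graphs with $G$ connected. Then $$\xi(G \odot H) \le \beta(\widehat{G})\,\mathrm{n}(H) + \mathrm{n}(G).$$
   Context: All graphs are finite, simple and undirected; $\mathrm{n}(H)$ denotes the order of $H$. For a connected graph $\Gamma$, a set $S\subseteq V(\Gamma)$ is a distance-equalizer set if for every two distinct $u,v\in V(\Gamma)\setminus S$ there is $w\in S$ with $d_\Gamma(w,u)=d_\Gamma(w,v)$; $\xi(\Gamma)$ is the minimum cardinality of a distance-equalizer set of $\Gamma$. For $V(G)=\{v_1,\dots,v_n\}$, the corona product $G\odot H$ is obtained from $G$ and $n$ pairwise disjoint copies $H_1,\dots,H_n$ of $H$ by joining $v_i$ to every vertex of $H_i$. The empty bisector graph $\widehat{G}$ has vertex set $V(G)$, with distinct $u,v$ adjacent iff there is no $w\in V(G)$ with $d_G(w,u)=d_G(w,v)$. $\beta$ denotes the vertex cover number. *)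

(* Defs.v *)
From HB Require Import structures.
From mathcomp Require Import all_boot.

Set Implicit Arguments.
Unset Strict Implicit.
Unset Printing Implicit Defensive.

Record sgraph := SGraph {
  vertex :> finType;
  adj : rel vertex;
  adj_sym : symmetric adj;
  adj_irr : irreflexive adj
}.

Section Invariants.
Variable G : sgraph.
Implicit Types (u v w : G) (S : {set G}).

Definition connected := forall u v, connect (@adj G) u v.

Definition walk_of_length (k : nat) u v : bool :=
  [exists p : k.-tuple G, path (@adj G) u p && (last u p == v)].

(* Shortest walks have length < #|G|; if no walk from u to v exists, [find]
   returns the out-of-range value #|G|. *)
Definition dist u v : nat :=
  find (fun k => walk_of_length k u v) (iota 0 #|G|).

Definition distance_equalizer S : bool :=
  [forall u, forall v,
     [&& u \notin S, v \notin S & u != v] ==>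
     [exists w in S, dist w u == dist w v]].

(* The full vertex set is vacuously a distance-equalizer set, hence the minimum
   is taken over a nonempty family; likewise for vertex covers. *)
Definition xi : nat :=
  #|[arg min_(S < [set: G] | distance_equalizer S) #|S| ]|.

Definition vertex_cover S : bool :=
  [forall u, forall v, adj u v ==> (u \in S) || (v \in S)].

Definition beta : nat :=
  #|[arg min_(S < [set: G] | vertex_cover S) #|S| ]|.

Definition empty_bisector_adj : rel G :=
  fun u v => (u != v) && ~~ [exists w, dist w u == dist w v].

Lemma empty_bisector_sym : symmetric empty_bisector_adj.
Proof.
move=> u v; rewrite /empty_bisector_adj eq_sym; congr (_ && ~~ _).
by apply: eq_existsb => w; rewrite eq_sym.
Qed.

Lemma empty_bisector_irr : irreflexive empty_bisector_adj.
Proof. by move=> u; rewrite /empty_bisector_adj eqxx. Qed.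

Definition empty_bisector_graph : sgraph :=
  SGraph empty_bisector_sym empty_bisector_irr.

End Invariants.

Section Corona.
Variables G H : sgraph.

(* [inl v] is the vertex v of G; [inr (v, x)] is the vertex x of the copy of H
   attached to v. *)
Definition corona_adj : rel (G + G * H)%type :=
  fun a b => match a, b with
  | inl u, inl v => adj u v
  | inl u, inr (v, _) => u == v
  | inr (u, _), inl v => u == v
  | inr (u, x), inr (v, y) => (u == v) && adj x y
  end.

Lemma corona_sym : symmetric corona_adj.
Proof.
case=> [u|[u x]] [v|[v y]] //=; first exact: adj_sym.
by rewrite eq_sym adj_sym.
Qed.

Lemma corona_irr : irreflexive corona_adj.
Proof. by case=> [u|[u x]] /=; rewrite adj_irr ?andbF. Qed.

Definition corona : sgraph := SGraph corona_sym corona_irr.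

End Corona.

(* Main.v *)
Require Import Defs.
From HB Require Import structures.
From mathcomp Require Import all_boot.

Set Implicit Arguments.
Unset Strict Implicit.
Unset Printing Implicit Defensive.

(** Let B be a minimum vertex cover of the empty bisector graph of G, and let S
    consist of V(G) together with the copies of H attached to the vertices of B.
    Two vertices outside S lie in copies attached to u, v outside B; as B is a
    vertex cover, u and v are equidistant from some w in G. Since w is at
    distance d(w, u) + 1 from every vertex of the copy attached to u, the vertex
    w of S equalizes the two vertices. *)

Section Distance.
Variable G : sgraph.
Implicit Types (u v : G) (S : {set G}) (p : seq G).

Lemma walk_of_lengthP k u v :
  reflect (exists p, [/\ path (@adj G) u p, last u p = v & size p = k])
          (walk_of_length k u v).
Proof.
apply: (iffP existsP) => [[p /andP[up /eqP lp]]|[p [up lp /eqP sp]]].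
  by exists p; rewrite size_tuple.
by exists (Tuple sp); rewrite up lp eqxx.
Qed.

(** The bound [k < #|G|] keeps [k] inside the range that [find] searches, so the default value
    [#|G|] cannot arise. *)
Lemma dist_eq k u v :
  k < #|G| -> walk_of_length k u v ->
  (forall j, j < k -> ~~ walk_of_length j u v) -> dist u v = k.
Proof.
move=> ltkG wk min_k; rewrite /dist; set a := fun j => _.
have hask : has a (iota 0 #|G|) by apply/hasP; exists k; rewrite ?mem_iota.
have lt_find : find a (iota 0 #|G|) < #|G| by rewrite -[ltnRHS](size_iota 0) -has_find.
case: (ltngtP (find a (iota 0 #|G|)) k) => // [lt_fk|lt_kf].
  by have := nth_find 0 hask; rewrite nth_iota // /a (negPf (min_k _ lt_fk)).
by have := before_find 0 lt_kf; rewrite nth_iota // /a wk.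
Qed.

Lemma connected_dist u v (connG : connected G) :
  [/\ dist u v < #|G|, walk_of_length (dist u v) u v
    & forall j, j < dist u v -> ~~ walk_of_length j u v].
Proof.
have [k ltkG wk] : exists2 k, k < #|G| & walk_of_length k u v.
  case/connectP: (connG u v) => p0 p0P ->; case: (shortenP p0P) => p pP up _.
  exists (size p); last by apply/walk_of_lengthP; exists p.
  (* The vertices of [u :: p] are distinct, so [(size p).+1 <= #|G|]. *)
  by have /card_uniqP /= <- := up; apply: max_card.
have exk : exists k, walk_of_length k u v by exists k.
case: (ex_minnP exk) => m wm min_m.
have ltmG : m < #|G| := leq_ltn_trans (min_m _ wk) ltkG.
have nwm j : j < m -> ~~ walk_of_length j u v.
  by apply: contraL => /min_m; rewrite leqNgt.
by rewrite (dist_eq ltmG wm nwm).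
Qed.

Lemma xi_le S : distance_equalizer S -> xi G <= #|S|.
Proof.
move=> eqS; rewrite /xi; case: arg_minnP => [|T _]; last exact.
by apply/forallP=> u; apply/forallP=> v; rewrite in_setT.
Qed.

Lemma beta_witness : exists2 S : {set G}, vertex_cover S & #|S| = beta G.
Proof.
rewrite /beta; case: arg_minnP => [|S covS _]; last by exists S.
by apply/forallP=> u; apply/forallP=> v; rewrite in_setT implybT.
Qed.

End Distance.

Section CoronaDistance.
Variables G H : sgraph.
Implicit Types a b : corona G H.

Definition corona_base a : G :=
  match a with inl v => v | inr (v, _) => v end.

Definition in_copy a : bool := if a is inr _ then true else false.

(* Contracting each copy of H onto its vertex of G projects walks; the
   [in_copy] terms account for the steps between G and the copies. *)
Lemma corona_walk_project a p :
  path (@adj (corona G H)) a p ->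
  exists q, [/\ path (@adj G) (corona_base a) q,
    last (corona_base a) q = corona_base (last a p)
    & size q + in_copy (last a p) <= size p + in_copy a].
Proof.
elim: p a => [|b p IHp] a /=; first by exists [::].
case/andP=> adj_ab /IHp[q [qP ql qs]].
case: a b adj_ab qP ql qs => [u|[u x]] [v|[v y]] /=.
- move=> uv qP ql qs; exists (v :: q); rewrite /= uv.
  by split=> //; rewrite !addSn ltnS.
- by move=> /eqP-> qP ql qs; exists q; split; rewrite // addn0 -addn1.
- move=> /eqP-> qP ql qs; exists q; split=> //.
  by apply: leq_trans qs _; rewrite addn0 addn1 ltnW.
- move=> /andP[/eqP-> _] qP ql qs; exists q; split=> //.
  by apply: leq_trans qs _; rewrite leq_add2r.
Qed.

(** A shortest walk of [G] extended by the edge into the copy attains this length; a shorter walk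
    would project to a walk of [G] shorter than [dist w v]. *)
Lemma corona_dist_copy (w v : G) (x : H) (connG : connected G) :
  dist (inl w : corona G H) (inr (v, x)) = (dist w v).+1.
Proof.
have [ltG /walk_of_lengthP[p [pP pl ps]] min_d] := connected_dist w v connG.
apply: dist_eq.
(* The vertex [x] makes [H] nonempty, which gives the corona the room needed for the extra step. *)
- rewrite card_sum card_prod.
  have ltG0 : 0 < #|G| := leq_ltn_trans (leq0n _) ltG.
  have ltH0 : 0 < #|H| by apply/card_gt0P; exists x.
  by apply: leq_ltn_trans ltG _; rewrite -[ltnLHS]addn0 ltn_add2l muln_gt0 ltG0.
- apply/walk_of_lengthP; exists (rcons (map inl p) (inr (v, x))).
  rewrite rcons_path last_rcons size_rcons size_map ps last_map pl /= eqxx andbT.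
  by split=> //; rewrite path_map.
move=> j ltj; apply/negP => /walk_of_lengthP[r [rP rl rs]].
have [q [/= qP ql]] := corona_walk_project rP.
(* The walk starts in [G] and ends in a copy, so the [in_copy] terms leave [size q < j]. *)
rewrite rl /= in ql *; rewrite rs addn1 addn0 => ltqj.
have /min_d/negP[] : size q < dist w v by apply: leq_trans ltqj _.
by apply/walk_of_lengthP; exists q.
Qed.

End CoronaDistance.

Theorem theorem21 (G H : sgraph) (connG : connected G) :
  xi (corona G H) <= beta (empty_bisector_graph G) * #|H| + #|G|.
Proof.
have [B /forallP covB <-] := beta_witness (empty_bisector_graph G).
pose S : {set corona G H} :=
  (inr @: setX (B : {set G}) [set: H]) :|: (inl @: [set: G]).
have inlS w : (inl w : corona G H) \in S.
  by rewrite inE; apply/orP; right; apply: imset_f.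
apply: (@leq_trans #|S|); last first.
  apply: leq_trans (leq_card_setU _ _) _.
  by apply: leq_add; apply: leq_trans (leq_imset_card _ _) _;
    rewrite ?cardsX !cardsT.
apply/xi_le/forallP=> a; apply/forallP=> b; apply/implyP => /and3P[].
case: a b => [u|[u x]] [v|[v y]]; rewrite ?inlS // => aS bS _.
have notinB z t : (inr (z, t) : corona G H) \notin S -> z \notin (B : {set G}).
  apply: contra => zB; rewrite inE; apply/orP; left.
  by apply: imset_f; rewrite !inE zB.
have [w dw] : exists w, dist w u = dist w v.
  (* Inside a single copy the cover gives no information, but any [w] works. *)
  have [->|neq_uv] := eqVneq u v; first by exists v.
  have /forallP/(_ v) := covB u.
  rewrite (negPf (notinB _ _ aS)) (negPf (notinB _ _ bS)) implybF.
  by rewrite /= /empty_bisector_adj neq_uv negbK => /existsP[w /eqP]; exists w.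
by apply/existsP; exists (inl w); rewrite inlS !corona_dist_copy // dw /=.
Qed.
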